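(* Let $d\ge3$ be an integer, $t\in(-1,1)$, and let $W_{d-1}=2|\mathbb{1}_{d-1}\rangle\langle\mathbb{1}_{d-1}|-I_{d-1}\in M_{d-1}(\mathbf{C})$, where $|\mathbb{1}_{d-1}\rangle\in\mathbf{C}^{d-1}$ is the vector all of whose entries are $(d-1)^{-1/2}$. For $m=1,\dots,d$ let $$A_m=S^{-m+1}\begin{pmatrix}t&0\\0&W_{d-1}\end{pmatrix}S^{m-1}\in M_d(\mathbf{C}).$$ Then $A_m^*=A_m$, and when $t\neq\tfrac{-1}{d-1}$: (a) the set of matrices $\{A_mA_n\}_{m,n=1}^d$ is linearly independent; (b) the map $\Phi(\rho)=\tfrac{1}{d-1+t^2}\sum_{m=1}^dA_m\rho A_m$ is an extreme point of both the set of CPT maps and the set of UCP maps on $M_d(\mathbf{C})$; (c) $\Phi$ is not factorizable.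
   Context: $\{e_1,\dots,e_d\}$ is the standard basis of $\mathbf{C}^d$ and $S=\sum_{k=1}^d|e_k\rangle\langle e_{k+1}|$ (indices mod $d$) is the cyclic shift. Linear maps $M_d(\mathbf{C})\to M_d(\mathbf{C})$ are called CPT if completely positive and trace-preserving, UCP if completely positive and unital, UCPT if both. Let $\mathcal{N}$ be a von Neumann algebra with a normal faithful trace $\tau$ normalized so that $\tau(I_{\mathcal{N}})=1$. A UCPT map $\Phi$ has an exact factorization through $M_d(\mathbf{C})\otimes\mathcal{N}$ if there is a unitary $\mathbf{U}\in M_d(\mathbf{C})\otimes\mathcal{N}$ with $\Phi(\rho)=(\mathcal{I}\otimes\tau)\big(\mathbf{U}^*(\rho\otimes I_{\mathcal{N}})\mathbf{U}\big)$ for all $\rho$; it is factorizable if this holds for some such $(\mathcal{N},\tau)$. Linear independence refers to the family of $d^2$ matrices indexed by pairs $(m,n)$. *)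

(* Defs.v *)
From HB Require Import structures.
From mathcomp Require Import all_boot all_order all_algebra.
From mathcomp Require Import complex.
From mathcomp Require Import all_classical all_reals all_analysis.

Set Implicit Arguments.
Unset Strict Implicit.
Unset Printing Implicit Defensive.

Import Order.TTheory GRing.Theory Num.Theory Num.Def.
Import numFieldNormedType.Exports.

Local Open Scope classical_set_scope.
Local Open Scope ring_scope.
Local Open Scope complex_scope.
Local Open Scope sesquilinear_scope.

Section Extreme.
Variables (R : realType) (V : lmodType R[i]).

Definition extreme_point (K : set V) (x : V) : Prop :=
  K x /\ forall (y z : V) (s : R), K y -> K z -> 0 < s < 1 ->
    x = s%:C *: y + (1 - s)%:C *: z -> y = x /\ z = x.

End Extreme.

Section Channels.
Variables (R : realType) (d : nat).
Local Notation C := R[i].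

Definition psdmx (k : nat) (M : 'M[C]_k) : Prop :=
  forall v : 'cV[C]_k, 0 <= (v^t* *m M *m v) 0 0.

(* M_k(C) (x) M_d(C) is the algebra of k x k block matrices with d x d blocks,
   on which I_k (x) Phi acts blockwise. *)
Definition completely_positive (Phi : 'M[C]_d -> 'M[C]_d) : Prop :=
  forall (k : nat) (M : 'M[C]_(\sum_(i < k) d, \sum_(j < k) d)),
    psdmx M -> psdmx (\mxblock_(i < k, j < k) Phi (submxblock M i j)).

Definition trace_preserving (Phi : 'M[C]_d -> 'M[C]_d) : Prop :=
  forall rho, \tr (Phi rho) = \tr rho.

Definition unital (Phi : 'M[C]_d -> 'M[C]_d) : Prop := Phi 1%:M = 1%:M.

Definition CPT : set ('M[C]_d -> 'M[C]_d) :=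
  [set Phi | [/\ linear Phi, completely_positive Phi & trace_preserving Phi]].

Definition UCP : set ('M[C]_d -> 'M[C]_d) :=
  [set Phi | [/\ linear Phi, completely_positive Phi & unital Phi]].

End Channels.

(* A complex Hilbert space is a complete normed space H over R[i] together with
   an inner product dot (linear in its first argument) inducing the norm. *)
Section VonNeumannAlgebras.
Variables (R : realType) (H : completeNormedModType R[i]).
Local Notation C := R[i].
Variable dot : {dot H for conjC}.

Definition norm_of_dot : Prop := forall x : H, `|x| ^+ 2 = dot x x.

(* For linear maps, continuity is boundedness. *)
Definition bounded_op : set (H -> H) := [set T | linear T /\ continuous T].

Definition is_adjoint (T T' : H -> H) : Prop :=
  forall x y : H, dot (T x) y = dot x (T' y).

(* Default value 0 when there is no adjoint; this does not occur for bounded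
   operators on a Hilbert space. *)
Definition adjoint (T : H -> H) : H -> H :=
  xget 0 [set T' | is_adjoint T T'].

Definition commutant (N : set (H -> H)) : set (H -> H) :=
  [set T | bounded_op T /\ forall X, N X -> T \o X = X \o T].

Record von_neumann_algebra (N : set (H -> H)) : Prop := {
  vna_bounded : N `<=` bounded_op;
  vna_adjoint : forall T, N T -> exists2 T', N T' & is_adjoint T T';
  vna_bicommutant : commutant (commutant N) = N
}.

Definition op_le (S T : H -> H) : Prop := forall x : H, 0 <= dot (T x - S x) x.

Definition op_directed (D : set (H -> H)) : Prop :=
  D !=set0 /\
  forall S T, D S -> D T -> exists U, [/\ D U, op_le S U & op_le T U].

Definition op_lub (N D : set (H -> H)) (T : H -> H) : Prop :=
  [/\ N T, forall S, D S -> op_le S T &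
      forall T', N T' -> (forall S, D S -> op_le S T') -> op_le T T'].

(* Normality: tau preserves suprema of upward directed families of positive
   elements of N; suprema of scalars are taken for the partial order of C, for
   which x <= y means that y - x is a nonnegative real. *)
Record normal_faithful_trace (N : set (H -> H)) (tau : (H -> H) -> C) : Prop := {
  nft_linear : forall (a : C) S T, N S -> N T ->
    tau (a *: S + T) = a * tau S + tau T;
  nft_positive : forall T, N T -> 0 <= tau (adjoint T \o T);
  nft_tracial : forall S T, N S -> N T -> tau (S \o T) = tau (T \o S);
  nft_faithful : forall T, N T -> tau (adjoint T \o T) = 0 -> T = 0;
  nft_normal : forall (D : set (H -> H)) (T : H -> H),
    D `<=` N -> (forall S, D S -> op_le 0 S) -> op_directed D ->
    op_lub N D T -> supremums (tau @` D) (tau T);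
  nft_normalized : tau idfun = 1
}.

(* M_d(C) (x) N is the algebra M_d(N) of d x d matrices with entries in N. *)
Section OperatorMatrices.
Variable d : nat.

Definition opmx_mul (A B : 'M[H -> H]_d) : 'M[H -> H]_d :=
  \matrix_(i, j) \sum_(k < d) (A i k \o B k j).

Definition opmx_adjoint (A : 'M[H -> H]_d) : 'M[H -> H]_d :=
  \matrix_(i, j) adjoint (A j i).

(* rho (x) I *)
Definition opmx_scalar (rho : 'M[C]_d) : 'M[H -> H]_d :=
  \matrix_(i, j) (rho i j *: (idfun : H -> H)).

Definition opmx_unitary (U : 'M[H -> H]_d) : Prop :=
  opmx_mul (opmx_adjoint U) U = opmx_scalar 1%:M /\
  opmx_mul U (opmx_adjoint U) = opmx_scalar 1%:M.

Definition exact_factorization (N : set (H -> H)) (tau : (H -> H) -> C)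
    (Phi : 'M[C]_d -> 'M[C]_d) : Prop :=
  exists U : 'M[H -> H]_d,
    [/\ forall i j, N (U i j), opmx_unitary U &
        forall rho : 'M[C]_d, Phi rho =
          map_mx tau (opmx_mul (opmx_mul (opmx_adjoint U) (opmx_scalar rho)) U)].

End OperatorMatrices.

End VonNeumannAlgebras.

Definition factorizable (R : realType) (d : nat)
    (Phi : 'M[R[i]]_d -> 'M[R[i]]_d) : Prop :=
  exists (H : completeNormedModType R[i]) (dot : {dot H for conjC})
    (N : set (H -> H)) (tau : (H -> H) -> R[i]),
    [/\ norm_of_dot dot, von_neumann_algebra dot N,
        normal_faithful_trace dot N tau & exact_factorization dot N tau Phi].

(* Here d = n.+1 = 1 + n, so that d - 1 = n. *)
Section Construction.
Variables (R : realType) (n : nat).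
Local Notation C := R[i].

Definition shift_mx : 'M[C]_n.+1 := \sum_(k < n.+1) delta_mx k (ordS k).

Definition ones_vec : 'cV[C]_n := const_mx (sqrtC n%:R)^-1.

Definition W_mx : 'M[C]_n := 2 *: (ones_vec *m ones_vec^t*) - 1%:M.

(* The index m is 0-based: A_mx t m is A_(m+1). *)
Definition A_mx (t : R) (m : 'I_n.+1) : 'M[C]_n.+1 :=
  shift_mx ^- m * (block_mx (t%:C)%:M 0 0 W_mx : 'M[C]_(1 + n)) * shift_mx ^+ m.

Definition Phi_map (t : R) (rho : 'M[C]_n.+1) : 'M[C]_n.+1 :=
  ((n%:R + t ^+ 2)^-1)%:C *: \sum_(m < n.+1) (A_mx t m *m rho *m A_mx t m).

End Construction.

(* Main.v *)
(* Write A_m = (1+t) E_mm - 1 + (2/n) u_m u_m^T with d = n+1 and u_m the sum of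
   the basis vectors other than e_m. If the sum of c_mm' A_m A_m' vanishes, its
   off-diagonal entries express each c_ij (i <> j) as an affine function of row
   and column sums, with coefficient 1 + nt in front of c_ij; summing over rows
   and columns kills these sums, and the diagonal entries then kill c_mm.

   Extremality is Choi's argument: if s Y + (1-s) Z = Phi, the positive form of
   the Choi matrix of Y is dominated by that of Phi, so it vanishes where the
   latter does, hence Y(rho) is a sum of c_mm' A_m rho A_m'^*. Trace
   preservation (resp. unitality) and independence force c to be that of Phi.

   For (c), faithfulness of the trace gives in the same way
   U = sum_m A_m^* (x) v_m; unitarity and independence yield
   v_m^* v_m' = v_m v_m'^* = p delta_mm' for the normalization constant p > 0,
   which is impossible for two distinct indices since
   p v_0^* = v_0^* (v_1 v_1^* ) = (v_0^* v_1) v_1^* = 0. *)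
Require Import Defs.
From HB Require Import structures.
From mathcomp Require Import all_boot all_order all_algebra.
From mathcomp Require Import complex.
From mathcomp Require Import all_classical all_reals all_analysis.
From mathcomp Require Import fingroup perm.
From mathcomp Require Import ring.

Set Implicit Arguments.
Unset Strict Implicit.
Unset Printing Implicit Defensive.

Import Order.TTheory GRing.Theory Num.Theory Num.Def.
Import numFieldNormedType.Exports.

Local Open Scope classical_set_scope.
Local Open Scope ring_scope.
Local Open Scope complex_scope.
Local Open Scope sesquilinear_scope.

Lemma sum_deltal (C : pzSemiRingType) (I : finType) (i : I) (f : I -> C) :
  \sum_k (k == i)%:R * f k = f i.
Proof.
rewrite (bigD1 i) //= eqxx mul1r big1 ?addr0 // => k /negbTE ->.
by rewrite mul0r.
Qed.

(** * Independence of the products *)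

Section Entries.
Variables (C : numFieldType) (n : nat) (t : C).
Hypotheses (n_ge2 : (2 <= n)%N) (t_gtN1 : -1 < t) (t_lt1 : t < 1).
Local Notation d := n.+1.
Implicit Types i j k m : 'I_d.
Local Notation delta i j := ((i == j)%:R : C).

Definition A_entry m i j : C :=
  (1 + t) * (delta i m * delta j m) - delta i j
  + 2 / n%:R * ((1 - delta i m) * (1 - delta j m)).

(** Along a row or a column of [A_m] the entry, as a function of the summation index [k], has the
    shape a + b δ_km - δ_ki. This one sum therefore evaluates every product of two such matrices. *)
Lemma sum_affine_delta_mul (a a' b b' : C) m m' i j :
  \sum_k (a + b * delta k m - delta k i) * (a' + b' * delta k m' - delta k j)
  = a * a' * d%:R + a * b' - a + b * a' + b * b' * delta m m' - b * delta m j
    - a' - b' * delta i m' + delta i j.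
Proof.
under eq_bigr => k _.
  rewrite (_ : _ * _ = a * a' + delta k m' * (a * b') - delta k j * a
     + delta k m * (b * a' + b * b' * delta k m' - b * delta k j)
     - delta k i * (a' + b' * delta k m' - delta k j)); last by ring.
  over.
rewrite /= !(big_split, sumrN) /= !sum_deltal sumr_const card_ord -mulr_natr.
ring.
Qed.

Lemma natn_neq0 : n%:R != 0 :> C.
Proof. by rewrite pnatr_eq0; case: n n_ge2. Qed.

(** W is a reflection, so W^2 = 1 and [A_m] squares to a diagonal matrix. The squares are thus
    invisible in the off-diagonal entries. *)
Lemma A_entry_sqr m i j :
  \sum_k A_entry m i k * A_entry m k j = delta i j * (1 + (t ^+ 2 - 1) * delta i m).
Proof.
have n0 := natn_neq0.
pose x l := (1 + t) * delta l m; pose y l := 2 / n%:R * (1 - delta l m).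
under eq_bigr => k _.
  rewrite (_ : _ * _ = (y i + (x i - y i) * delta k m - delta k i)
     * (y j + (x j - y j) * delta k m - delta k j)); last first.
    by rewrite /A_entry /x /y (eq_sym i k); ring.
  over.
rewrite sum_affine_delta_mul /x /y eqxx (eq_sym m j) -natr1.
case: (eqVneq i m) => [->|im]; case: (eqVneq j m) => jm; rewrite ?eqxx ?jm //=.
- by field.
- by field.
- by rewrite (negbTE im) /=; field.
by case: eqP => _; field.
Qed.

(** The factor n^2/2 clears denominators. Only the last term couples m with m', so in a linear
    relation an individual coefficient survives only through 1 + nt; the other terms produce row,
    column and total sums. *)
Lemma A_entry_mul m m' i j : m != m' -> i != j ->
  n%:R ^+ 2 / 2 * \sum_k A_entry m i k * A_entry m' k j
  = - 2 + (n%:R * t + 2) * (delta m i + delta m' j)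
    + n%:R * (delta m' i + delta m j)
    - 2 * (1 + n%:R * t) * (delta m i * delta m' j).
Proof.
move=> mm' ij; have n0 := natn_neq0.
pose x l m := (1 + t) * delta l m; pose y l m := 2 / n%:R * (1 - delta l m).
under eq_bigr => k _.
  rewrite (_ : _ * _ = (y i m + (x i m - y i m) * delta k m - delta k i)
     * (y j m' + (x j m' - y j m') * delta k m' - delta k j)); last first.
    by rewrite /A_entry /x /y (eq_sym i k); ring.
  over.
rewrite sum_affine_delta_mul /x /y (negbTE mm') (negbTE ij) -natr1.
rewrite !(eq_sym _ m) !(eq_sym _ m').
case: (eqVneq m i) => [mi|mi]; case: (eqVneq m j) => [mj|mj].
- by move: ij; rewrite -mi -mj eqxx.
all: case: (eqVneq m' i) => [m'i|m'i]; case: (eqVneq m' j) => [m'j|m'j].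
all: try by [move: mm'; rewrite mi m'i eqxx | move: mm'; rewrite mj m'j eqxx
  | move: ij; rewrite -m'i -m'j eqxx].
all: by rewrite /=; field.
Qed.

Lemma sum_bilinear_delta (x : 'I_d -> 'I_d -> C) (c0 c1 c2 c3 : C) i j :
  \sum_m \sum_m' x m m' * (c0 + c1 * (delta m i + delta m' j)
     + c2 * (delta m' i + delta m j) + c3 * (delta m i * delta m' j))
  = c0 * (\sum_m \sum_m' x m m')
    + c1 * (\sum_k x i k + \sum_k x k j)
    + c2 * (\sum_k x k i + \sum_k x j k) + c3 * x i j.
Proof.
under eq_bigr => m _.
  under eq_bigr => m' _.
    rewrite (_ : _ * _ = c0 * x m m' + delta m i * (c1 * x m m')
      + delta m' j * (c1 * x m m')
      + delta m' i * (c2 * x m m') + delta m j * (c2 * x m m')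
      + delta m' j * (delta m i * (c3 * x m m'))); last by ring.
    over.
  rewrite !big_split /= !sum_deltal -!mulr_sumr.
  over.
by rewrite /= !big_split /= !sum_deltal -!mulr_sumr; ring.
Qed.

(** This is the coefficient of a row sum in the relation [ps] of the next proof. It equals
    n(n-3)(1+t) + 4(n-1), clearly positive for n >= 3; for n = 2 the first term is negative and the
    value is 2(1-t). *)
Lemma pcoef_gt0 : 0 < n%:R ^+ 2 * t - 3 * n%:R * t + n%:R ^+ 2 + n%:R - 4.
Proof.
have t1_gt0 : 0 < 1 + t by rewrite -ltrBlDl sub0r.
case: n n_ge2 => [|[|[|k]]] // _.
  rewrite (_ : _ - _ = 2 * (1 - t)); last by ring.
  by rewrite mulr_gt0 // subr_gt0.
rewrite (_ : _ - _ = (k%:R + 3) * k%:R * (1 + t) + 4 * k.+2%:R); last first.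
  by rewrite -!natr1; ring.
apply: ltr_wpDl; last by rewrite mulr_gt0 ?ltr0n.
by rewrite mulr_ge0 ?(ltW t1_gt0) // -natrD -natrM ler0n.
Qed.

Lemma offdiag_products_free (x : 'I_d -> 'I_d -> C) :
  1 + n%:R * t != 0 -> (forall m, x m m = 0) ->
  (forall i j, i != j ->
     \sum_m \sum_m' x m m' * (\sum_k A_entry m i k * A_entry m' k j) = 0) ->
  forall i j, x i j = 0.
Proof.
move=> nt0 xd x0 i j.
pose s := \sum_m \sum_m' x m m'; pose a i := \sum_k x i k.
pose b j := \sum_k x k j.
(* Off the diagonal [F] is n^2/2 times the entry of the vanishing combination. The formula is kept
   on the diagonal too, where it need not vanish but simplifies because [x i i] is 0. *)
pose F i j := - 2 * s + (n%:R * t + 2) * (a i + b j) + n%:R * (b i + a j)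
  - 2 * (1 + n%:R * t) * x i j.
have F0 i' j' : i' != j' -> F i' j' = 0.
  move=> ij; rewrite /F -mulNr -sum_bilinear_delta.
  transitivity (n%:R ^+ 2 / 2 *
     \sum_m \sum_m' x m m' * (\sum_k A_entry m i' k * A_entry m' k j')).
    rewrite mulr_sumr; apply: eq_bigr => m _; rewrite mulr_sumr.
    apply: eq_bigr => m' _; have [<-|mm'] := eqVneq m m'.
      by rewrite xd !mul0r mulr0.
    by rewrite [RHS]mulrCA A_entry_mul // mulNr.
  by rewrite x0 // mulr0.
have bs : \sum_j b j = s by rewrite /b exchange_big.
(* A row or column sum of [F] reduces to its diagonal term. Computing both sides gives linear
   relations between [a], [b] and [s] alone. *)
have E1 i' : \sum_j F i' j = F i' i'.
  by rewrite (bigD1 i') //= big1 ?addr0 // => k; rewrite eq_sym => /F0.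
have E2 j' : \sum_i F i j' = F j' j'.
  by rewrite (bigD1 j') //= big1 ?addr0 // => k /F0.
have sumc (y : C) : \sum_(k < d) y = y * d%:R.
  by rewrite sumr_const card_ord mulr_natr.
have as_ : \sum_i a i = s by [].
have {}E1 i' : - 2 * s * d%:R + (n%:R * t + 2) * (a i' * d%:R + s)
    + n%:R * (b i' * d%:R + s) - 2 * (1 + n%:R * t) * a i'
    = - 2 * s + (n%:R * t + 2 + n%:R) * (a i' + b i').
  transitivity (F i' i'); last by rewrite /F xd; ring.
  rewrite -E1 /F !big_split /= sumrN -!mulr_sumr !big_split /= as_ bs -/(a i').
  by rewrite !sumc mulrA.
have {}E2 i' : - 2 * s * d%:R + (n%:R * t + 2) * (s + b i' * d%:R)
    + n%:R * (s + a i' * d%:R) - 2 * (1 + n%:R * t) * b i'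
    = - 2 * s + (n%:R * t + 2 + n%:R) * (a i' + b i').
  transitivity (F i' i'); last by rewrite /F xd; ring.
  rewrite -E2 /F !big_split /= sumrN -!mulr_sumr !big_split /= as_ bs -/(b i').
  by rewrite !sumc mulrA.
have n0 := natn_neq0.
have n1 : n%:R - 1 != 0 :> C.
  by rewrite subr_eq0 (eqr_nat C n 1); case: n n_ge2 => [|[|]].
(* The difference of the two relations is n(n-1)(1-t) times [a i' - b i'], and this factor is
   nonzero since n >= 2 and t < 1. *)
have ab i' : a i' = b i'.
  apply/eqP; rewrite -subr_eq0.
  have /eqP : n%:R * (n%:R - 1) * (1 - t) * (a i' - b i') = 0.
    move: (E1 i') (E2 i') => /eqP + /eqP; rewrite -subr_eq0 => /eqP e1.
    rewrite -subr_eq0 => /eqP e2.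
    have := congr2 (fun y z => y - z) e2 e1.
    by rewrite subrr => <-; rewrite -natr1; ring.
  rewrite !mulf_eq0 (negbTE n0) (negbTE n1) (subr_eq0 1) (eq_sym 1).
  by rewrite (lt_eqF t_lt1).
pose P : C := n%:R ^+ 2 * t - 3 * n%:R * t + n%:R ^+ 2 + n%:R - 4.
have ps i' : P * a i' + (n%:R * t - n%:R + 2) * s = 0.
  move: (E1 i') => /eqP; rewrite -subr_eq0 => /eqP.
  by rewrite -ab => e; rewrite -e -natr1 /P; ring.
(* Summing [ps] over all indices gives 2(n-1)(1+nt) s = 0; here 1 + nt must not vanish. *)
have s0 : s = 0.
  have : \sum_i' (P * a i' + (n%:R * t - n%:R + 2) * s) = 0.
    by rewrite big1.
  rewrite big_split /= -mulr_sumr sumc -/s => e.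
  apply/eqP; have /eqP : 2 * (n%:R - 1) * (1 + n%:R * t) * s = 0.
    by rewrite -e -natr1 /P; ring.
  by rewrite !mulf_eq0 (negbTE n1) (negbTE nt0) pnatr_eq0.
have a0 i' : a i' = 0.
  apply/eqP; move: (ps i') => /eqP; rewrite s0 mulr0 addr0 mulf_eq0.
  by rewrite gt_eqF // pcoef_gt0.
have [->|ij] := eqVneq i j; first by rewrite xd.
apply/eqP; move: (F0 _ _ ij) => /eqP; rewrite /F s0 -!ab !a0 !(addr0, mulr0).
by rewrite add0r oppr_eq0 !mulf_eq0 (negbTE nt0) pnatr_eq0.
Qed.

Lemma A_entry_products_free (c : 'I_d -> 'I_d -> C) :
  1 + n%:R * t != 0 ->
  (forall i j,
     \sum_m \sum_m' c m m' * (\sum_k A_entry m i k * A_entry m' k j) = 0) ->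
  forall i j, c i j = 0.
Proof.
move=> nt0 c0.
(* [x] is [c] with its diagonal erased; since squares are diagonal matrices, this leaves the
   off-diagonal entries of the combination unchanged. *)
pose x m m' := if m == m' then 0 else c m m'.
have x0 : forall i j, x i j = 0.
  apply: offdiag_products_free => // [m|i j ij]; first by rewrite /x eqxx.
  rewrite -[RHS](c0 i j); apply: eq_bigr => m _; apply: eq_bigr => m' _.
  rewrite /x; have [<-|//] := eqVneq.
  by rewrite A_entry_sqr (negbTE ij) mulr0n !mul0r mulr0.
have cE m m' : c m m' = delta m m' * c m m.
  move: (x0 m m'); rewrite /x; have [<-|_ ->] := eqVneq; first by rewrite mul1r.
  by rewrite mul0r.
pose s := \sum_m c m m.
have e i : s + (t ^+ 2 - 1) * c i i = 0.
  rewrite -[RHS](c0 i i).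
  under [RHS]eq_bigr => m _.
    under eq_bigr => m' _ do rewrite cE eq_sym -mulrA.
    rewrite sum_deltal A_entry_sqr eqxx mul1r mulrDr mulr1 mulrA mulrC eq_sym.
    over.
  by rewrite big_split /= sum_deltal mulrC.
(* Adding the d diagonal equations gives (n + t^2) s = 0, the trace of the relation. *)
have s0 : s = 0.
  have : \sum_(i < d) (s + (t ^+ 2 - 1) * c i i) = 0 by rewrite big1.
  rewrite big_split /= -mulr_sumr sumr_const card_ord -/s -mulr_natr => es.
  apply/eqP; have /eqP : (n%:R + t ^+ 2) * s = 0 by rewrite -es -natr1; ring.
  rewrite mulf_eq0 gt_eqF //= ltr_wpDr //; last first.
    by rewrite lt0r natn_neq0 ler0n.
  rewrite real_exprn_even_ge0 // -[t](addrK 1) realB ?real1 //.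
  by rewrite gtr0_real // addrC -ltrBlDl sub0r.
move=> i j; rewrite cE; apply/eqP; move: (e i) => /eqP.
rewrite s0 add0r (_ : t ^+ 2 - 1 = (t - 1) * (1 + t)); last by ring.
rewrite !mulf_eq0 subr_eq0 lt_eqF //= gt_eqF ?orbF //.
  by move=> /= /eqP ->; rewrite eqxx orbT.
by rewrite -ltrBlDl sub0r.
Qed.

End Entries.

Lemma sum_deltaZ (C : pzRingType) (V : lmodType C) (I : finType) (i : I)
    (f : I -> V) : \sum_k (k == i)%:R *: f k = f i.
Proof.
rewrite (bigD1 i) //= eqxx scale1r big1 ?addr0 // => k /negbTE ->.
by rewrite scale0r.
Qed.

(** * Families of vectors and positive forms *)

Section Families.
Variables (F : fieldType) (I J : finType) (G : J -> I -> F).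

(** [P] is the pseudo-inverse of [G] read as a matrix, GPG = G, transported along the enumerations
    of [I] and [J]. *)
Lemma generalized_inverse :
  exists P : I -> J -> F,
    forall m k, \sum_m' (\sum_l G m l * P l m') * G m' k = G m k.
Proof.
pose M := \matrix_(m < #|J|, k < #|I|) G (enum_val m) (enum_val k).
exists (fun l m => pinvmx M (enum_rank l) (enum_rank m)) => m k.
have := mulmxKpV (submx_refl M).
move/matrixP/(_ (enum_rank m) (enum_rank k)); rewrite !mxE !enum_rankK => <-.
rewrite [RHS](reindex_onto enum_rank enum_val); last first.
  by move=> ? _; rewrite enum_valK.
apply: eq_big => [m'|m' _]; first by rewrite enum_rankK eqxx.
rewrite !mxE !enum_rankK; congr (_ * _).
rewrite [RHS](reindex_onto enum_rank enum_val); last first.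
  by move=> ? _; rewrite enum_valK.
apply: eq_big => [l|l _]; first by rewrite enum_rankK eqxx.
by rewrite !mxE !enum_rankK.
Qed.

(** The columns of 1 - PG are relations annihilated by every [G m], and applying the hypothesis to
    column k gives the expansion of [f k]. [P] is chosen before [V] and [f], so one choice of
    coefficients serves several families. *)
Lemma family_in_span :
  exists P : I -> J -> F, forall (V : lmodType F) (f : I -> V),
    (forall w : I -> F, (forall m, \sum_k w k * G m k = 0) ->
       \sum_k w k *: f k = 0) ->
    forall k, f k = \sum_m G m k *: (\sum_l P l m *: f l).
Proof.
have [P GPG] := generalized_inverse; exists P => V f f0 k.
pose w l := (l == k)%:R - \sum_m P l m * G m k.
have /f0 : forall m, \sum_l w l * G m l = 0.
  move=> m; under eq_bigr => l _ do rewrite mulrBl.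
  rewrite sumrB sum_deltal -[X in X - _](GPG m k); apply/eqP.
  rewrite subr_eq0; apply/eqP; under eq_bigr => m' _ do rewrite mulr_suml.
  rewrite exchange_big; apply: eq_bigr => l _ /=; rewrite mulr_suml.
  by apply: eq_bigr => m' _; ring.
under eq_bigr => l _ do rewrite scalerBl.
rewrite sumrB sum_deltaZ => /eqP; rewrite subr_eq0 => /eqP ->.
under eq_bigr => l _ do rewrite scaler_suml.
rewrite exchange_big; apply: eq_bigr => m _ /=; rewrite scaler_sumr.
by apply: eq_bigr => l _; rewrite scalerA mulrC.
Qed.

(** Freeness turns GPG = G into GP = 1. This right inverse lets independence over the scalars act on
    coefficients in any module, in particular on operators. *)
Lemma free_family_module (V : lmodType F) (T : J -> V) :
  (forall c : J -> F, (forall k, \sum_m c m * G m k = 0) -> forall m, c m = 0) ->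
  (forall k, \sum_m G m k *: T m = 0) -> forall m, T m = 0.
Proof.
move=> Gfree T0 m; have [P GPG] := generalized_inverse.
have GP m1 m2 : \sum_l G m1 l * P l m2 = (m2 == m1)%:R.
  apply/eqP; rewrite -subr_eq0; apply/eqP.
  apply: (Gfree (fun m => \sum_l G m1 l * P l m - (m == m1)%:R)) => k.
  under eq_bigr => m' _ do rewrite mulrBl.
  by rewrite sumrB sum_deltal GPG subrr.
rewrite -[LHS](sum_deltaZ m); under eq_bigr => m' _.
  rewrite eq_sym -GP scaler_suml.
  under eq_bigr => l _ do rewrite mulrC -scalerA.
  over.
by rewrite exchange_big big1 // => l _; rewrite -scaler_sumr T0 scaler0.
Qed.

End Families.

Section PositiveForms.
Variables (C : numClosedFieldType) (I : finType).
Implicit Types u w : I -> C.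

(** Let X be the linear part at a fixed x. The points e x and -e x with e > 0 give |X| <= e Q, which
    for small e forces X = 0. Taking x = 1 and x = i then separates [a] from [b]. *)
Lemma quadratic_ge0_eq0 (a b q : C) :
  (forall x : C, 0 <= x * a + conjC x * b + x * conjC x * q) -> a = 0 /\ b = 0.
Proof.
move=> ge0; suff X0 x : x * a + conjC x * b = 0.
  have := X0 1; have := X0 'i%R; rewrite conjC1 conjCi !mul1r mulNr -mulrBr => /eqP.
  rewrite mulf_eq0 (negbTE (neq0Ci _)) subr_eq0 => /eqP -> /eqP.
  by rewrite -mulr2n mulrn_eq0 => /eqP ->.
set X := _ + _; pose Q := x * conjC x * q.
have pos e : 0 < e -> 0 <= X + e * Q.
  move=> e0; have ec : conjC e = e by rewrite conj_Creal // gtr0_real.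
  rewrite -(pmulr_rge0 _ e0); have := ge0 (e * x).
  by rewrite rmorphM /= ec /X /Q /=; congr (0 <= _); ring.
have neg e : 0 < e -> 0 <= - X + e * Q.
  move=> e0; have ec : conjC e = e by rewrite conj_Creal // gtr0_real.
  rewrite -(pmulr_rge0 _ e0); have := ge0 (- e * x).
  by rewrite rmorphM rmorphN /= ec /X /Q /=; congr (0 <= _); ring.
have Q0 : 0 <= Q.
  have := addr_ge0 (pos 1 ltr01) (neg 1 ltr01).
  by rewrite addrACA subrr add0r mul1r -mulr2n pmulrn_lge0.
have Xr : X \is Num.real.
  have := pos 1 ltr01 => /ger0_real; rewrite mul1r => h.
  by rewrite -(addrK Q X) realB // ger0_real.
have nX e : 0 < e -> `|X| <= e * Q.
  move=> e0; rewrite real_ler_norml //; apply/andP; split.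
    by rewrite -subr_ge0 opprK pos.
  by rewrite -subr_ge0 addrC neg.
have [->//|XN0] := eqVneq X 0.
have Q_gt0 : 0 < Q.
  rewrite lt0r Q0 andbT; apply: contraNneq XN0 => Qe.
  by rewrite -normr_le0 -[0](mulr0 1) -Qe nX.
have := nX (`|X| / (Q *+ 2)).
rewrite divr_gt0 ?normr_gt0 ?pmulrn_lgt0 // => /(_ isT).
rewrite (_ : _ / _ * Q = `|X| / 2); last by field; rewrite gt_eqF.
by rewrite ler_pdivlMr // mulr_natr mulr2n gerDl normr_le0 (negbTE XN0).
Qed.

Variable K : I -> I -> C.
Definition sesqui u w := \sum_k \sum_l conjC (u k) * K k l * w l.

Lemma sesquiDZ x u w :
  sesqui (fun k => w k + x * u k) (fun k => w k + x * u k)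
  = sesqui w w + (x * sesqui w u + conjC x * sesqui u w + x * conjC x * sesqui u u).
Proof.
rewrite /sesqui !mulr_sumr -!big_split; apply: eq_bigr => k _ /=.
rewrite !mulr_sumr -!big_split; apply: eq_bigr => l _ /=.
by rewrite rmorphD rmorphM /=; ring.
Qed.

(** Degenerate Cauchy-Schwarz: perturbing an isotropic vector [w] by x u leaves a nonnegative
    polynomial in x without constant term, so its linear terms vanish. Taking u in the standard
    basis yields both conclusions. *)
Lemma psd_sesqui_eq0 w : (forall u, 0 <= sesqui u u) -> sesqui w w = 0 ->
  (forall k, \sum_l w l * K k l = 0) /\ (forall l, \sum_k w k * conjC (K k l) = 0).
Proof.
move=> psd w0.
have uw0 u : sesqui w u = 0 /\ sesqui u w = 0.
  apply: quadratic_ge0_eq0 (sesqui u u) _ => x.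
  by have := psd (fun k => w k + x * u k); rewrite sesquiDZ w0 add0r.
split=> i.
  have [_] := uw0 (fun k => (k == i)%:R); rewrite /sesqui.
  under eq_bigr => k _.
    under eq_bigr => l _ do rewrite rmorph_nat -mulrA.
    rewrite -mulr_sumr; over.
  by rewrite sum_deltal => e; rewrite -[RHS]e; apply: eq_bigr => l _; rewrite mulrC.
have [+ _] := uw0 (fun k => (k == i)%:R); rewrite /sesqui => e.
apply: (can_inj (@conjCK C)); rewrite rmorph0 -[RHS]e rmorph_sum.
apply: eq_bigr => k _; rewrite rmorphM /= conjCK.
by under eq_bigr => l _ do rewrite mulrC; rewrite sum_deltal.
Qed.

(** The isotropic vectors provided by [G] lie in both radicals, so the rows of [K] and its
    conjugated columns expand in [G]. Using the same [P] on both sides makes the coefficient matrix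
    P^* K P. *)
Lemma psd_sesqui_span (J : finType) (G : J -> I -> C) :
  (forall u, 0 <= sesqui u u) ->
  (forall w, (forall m, \sum_k w k * G m k = 0) -> sesqui w w = 0) ->
  exists c : J -> J -> C, forall k l,
    K k l = \sum_m \sum_m' c m m' * (conjC (G m k) * G m' l).
Proof.
move=> psd K0; have [P spanP] := family_in_span G.
exists (fun m m' => \sum_k \sum_l conjC (P k m) * P l m' * K k l) => k l.
rewrite (spanP C^o (K k)); last first.
  by move=> w /K0 /(psd_sesqui_eq0 psd) [e _]; apply: e.
have {}spanP l' : K k l' = \sum_m conjC (G m k) * \sum_k' conjC (P k' m) * K k' l'.
  apply: (can_inj (@conjCK C)).
  rewrite (spanP C^o (fun k => conjC (K k l'))); last first.
    by move=> w /K0 /(psd_sesqui_eq0 psd) [_ e]; apply: e.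
  rewrite rmorph_sum; apply: eq_bigr => m _; rewrite rmorphM /= conjCK rmorph_sum.
  by congr (_ * _); apply: eq_bigr => k' _; rewrite rmorphM /= conjCK.
rewrite [RHS]exchange_big; apply: eq_bigr => m' _ /=.
rewrite /GRing.scale /=; under eq_bigr => l' _ do rewrite spanP mulr_sumr.
rewrite exchange_big mulr_sumr; apply: eq_bigr => m _ /=.
rewrite [in RHS]exchange_big mulr_suml mulr_sumr; apply: eq_bigr => l' _ /=.
rewrite mulr_suml !mulr_sumr; apply: eq_bigr => k' _.
by rewrite -!mulrA; ring.
Qed.

End PositiveForms.

Lemma sum_pairE (V : nmodType) (I J : finType) (f : I * J -> V) :
  \sum_k f k = \sum_i \sum_j f (i, j).
Proof. by rewrite pair_bigA; apply: eq_bigr => -[]. Qed.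

(** * Choi's extremality criterion *)

Section Choi.
Variables (R : realType) (d : nat).
Local Notation C := R[i].
Implicit Types (rho M : 'M[C]_d) (Y Z : 'M[C]_d -> 'M[C]_d).

Lemma trmxC_mul m n p (A : 'M[C]_(m, n)) (B : 'M[C]_(n, p)) :
  (A *m B)^t* = B^t* *m A^t*.
Proof. by rewrite trmx_mul map_mxM. Qed.

Lemma trmxCK m n (A : 'M[C]_(m, n)) : (A^t*)^t* = A.
Proof. by apply/matrixP => i j; rewrite !mxE conjCK. Qed.

Lemma psdmx_mxblock k (N : 'I_k -> 'I_k -> 'M[C]_d) :
  psdmx (\mxblock_(i < k, j < k) N i j) <->
  forall v : 'I_k -> 'cV[C]_d,
    0 <= \sum_i \sum_j ((v i)^t* *m N i j *m v j) 0 0.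
Proof.
have E (v : 'I_k -> 'cV[C]_d) :
    ((\mxcol_i v i)^t* *m (\mxblock_(i < k, j < k) N i j) *m \mxcol_i v i) 0 0
    = \sum_i \sum_j ((v i)^t* *m N i j *m v j) 0 0.
  rewrite tr_mxcol (_ : map_mx _ _ = \mxrow_i (v i)^t*); last first.
    by apply/matrixP => a b; rewrite !mxE.
  rewrite mul_mxrow_mxblock mul_mxrow_mxcol summxE exchange_big.
  apply: eq_bigr => j _ /=; rewrite mulmx_suml summxE; exact: eq_bigr.
split=> [h v|h v]; first by rewrite -E.
by rewrite -(submxcolK v) E.
Qed.

Lemma linear_choiE Y rho : linear Y ->
  Y rho = \sum_(k : 'I_d * 'I_d) rho k.1 k.2 *: Y (delta_mx k.1 k.2).
Proof.
move=> Ylin; pose L := GRing.isLinear.Build _ _ _ _ Y Ylin.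
pose Y' : {linear 'M[C]_d -> 'M[C]_d} := HB.pack Y L.
rewrite -[LHS]/(Y' rho) {1}(matrix_sum_delta rho) pair_big linear_sum.
by apply: eq_bigr => k _; rewrite linearZ.
Qed.

Lemma mxquadE (u v : 'cV[C]_d) M :
  (u^t* *m M *m v) 0 0 = \sum_a \sum_b conjC (u a 0) * M a b * v b 0.
Proof.
rewrite mxE exchange_big; apply: eq_bigr => b _; rewrite mxE mulr_suml.
by apply: eq_bigr => a _; rewrite !mxE.
Qed.

(* The pair (i, a) consists of an input index i and an output index a. *)
Definition choi_form Y (k l : 'I_d * 'I_d) : C :=
  Y (delta_mx k.1 l.1) k.2 l.2.

(** Complete positivity is tested on the block matrix whose blocks are the matrix units, a multiple
    of the projector onto the maximally entangled vector. Its own form is the squared modulus of the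
    sum of the [v i i 0]. *)
Lemma choi_form_psd Y : completely_positive Y ->
  forall w, 0 <= sesqui (choi_form Y) w w.
Proof.
move=> Ycp w.
have /Ycp : psdmx (\mxblock_(i < d, j < d) (delta_mx i j : 'M[C]_d)).
  apply/psdmx_mxblock => v.
  rewrite (_ : \sum_i _ = conjC (\sum_i v i i 0) * (\sum_i v i i 0)).
    by rewrite mulrC mul_conjC_ge0.
  rewrite rmorph_sum mulr_suml; apply: eq_bigr => i _; rewrite mulr_sumr.
  apply: eq_bigr => j _; rewrite mxquadE (bigD1 i) //= (bigD1 j) //= mxE !eqxx.
  rewrite mulr1 big1 ?addr0 => [|b /negbTE bj]; last first.
    by rewrite mxE bj andbF mulr0 mul0r.
  rewrite big1 ?addr0 // => a /negbTE ai.
  by rewrite big1 // => b _; rewrite mxE ai mulr0 mul0r.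
under eq_mxblock => i j do rewrite mxblockK.
move/psdmx_mxblock/(_ (fun i => \col_a w (i, a))).
congr (0 <= _); rewrite /sesqui sum_pairE; apply: eq_bigr => i _.
under [RHS]eq_bigr => a _ do rewrite sum_pairE.
rewrite exchange_big; apply: eq_bigr => j _ /=; rewrite mxquadE.
by apply: eq_bigr => a _; apply: eq_bigr => b _; rewrite !mxE.
Qed.

Variables (r : nat) (A : 'I_r -> 'M[C]_d) (p : C).
Hypothesis p_ge0 : 0 <= p.

Definition kraus_map rho := p *: \sum_m A m *m rho *m (A m)^t*.

Lemma kraus_linear : linear kraus_map.
Proof.
move=> a x y; rewrite /kraus_map scalerA mulrC -scalerA -scalerDr; congr (_ *: _).
rewrite scaler_sumr -big_split; apply: eq_bigr => m _ /=.
by rewrite mulmxDr mulmxDl -scalemxAr -scalemxAl.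
Qed.

(** Each Kraus term evaluates the form of [M] at the vectors [(A m)^t* *m v i]. *)
Lemma kraus_cp : completely_positive kraus_map.
Proof.
move=> k M; rewrite -{1}(submxblockK M) => /psdmx_mxblock Mpsd.
apply/psdmx_mxblock => v.
rewrite (_ : \sum_i _ = p * \sum_m \sum_i \sum_j
   (((A m)^t* *m v i)^t* *m submxblock M i j *m ((A m)^t* *m v j)) 0 0).
  by rewrite mulr_ge0 // sumr_ge0 // => m _; apply: Mpsd.
rewrite [in RHS]exchange_big /= mulr_sumr; apply: eq_bigr => i _.
rewrite [in RHS]exchange_big /= mulr_sumr; apply: eq_bigr => j _.
rewrite /kraus_map -scalemxAr -scalemxAl mxE mulmx_sumr mulmx_suml summxE.
congr (_ * _); apply: eq_bigr => m _; congr (fun_of_matrix _ _ _).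
by rewrite trmxC_mul trmxCK !mulmxA.
Qed.

Lemma delta_sandwich m m' i j a b :
  (A m *m delta_mx i j *m (A m')^t*) a b = A m a i * conjC (A m' b j).
Proof.
rewrite mxE (bigD1 j) //= big1 ?addr0 => [|k /negbTE kj].
  rewrite !mxE (bigD1 i) //= mxE !eqxx mulr1 big1 ?addr0 // => k /negbTE ki.
  by rewrite mxE ki mulr0.
rewrite !mxE big1 ?mul0r // => l _; by rewrite mxE kj andbF mulr0.
Qed.

Lemma kraus_choi_form k l :
  choi_form kraus_map k l = p * \sum_m A m k.2 k.1 * conjC (A m l.2 l.1).
Proof.
rewrite /choi_form /kraus_map mxE summxE.
by under eq_bigr => m _ do rewrite delta_sandwich.
Qed.

Lemma sesqui_kraus_eq0 w :
  (forall m, \sum_k w k * conjC (A m k.2 k.1) = 0) ->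
  sesqui (choi_form kraus_map) w w = 0.
Proof.
move=> w0; rewrite /sesqui big1 // => k _.
under eq_bigr => l _ do rewrite kraus_choi_form !mulr_sumr mulr_suml.
rewrite exchange_big big1 //= => m _.
rewrite (eq_bigr (fun l => conjC (w k) * p * A m k.2 k.1 *
   (w l * conjC (A m l.2 l.1)))); last by move=> l _; ring.
by rewrite -mulr_sumr w0 mulr0.
Qed.

Lemma dominated_by_kraus Y Z (s : C) : linear Y ->
  completely_positive Y -> completely_positive Z -> 0 < s -> s < 1 ->
  kraus_map = s *: Y + (1 - s) *: Z ->
  exists c : 'I_r -> 'I_r -> C, forall rho,
    Y rho = \sum_m \sum_m' c m m' *: (A m *m rho *m (A m')^t*).
Proof.
move=> Ylin Ycp Zcp s0 s1 E.
have [w /sesqui_kraus_eq0|c cE] :=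
    psd_sesqui_span (G := fun m k => conjC (A m k.2 k.1)) (choi_form_psd Ycp).
  (* The Choi form of the Kraus map is a convex combination with positive weights of two nonnegative
     forms, so where it vanishes the form of [Y] vanishes. *)
  rewrite (_ : sesqui _ w w = s * sesqui (choi_form Y) w w
     + (1 - s) * sesqui (choi_form Z) w w).
    move/eqP; rewrite paddr_eq0; last 2 first.
    - by rewrite mulr_ge0 ?(ltW s0) // choi_form_psd.
    - by rewrite mulr_ge0 ?subr_ge0 ?(ltW s1) // choi_form_psd.
    by rewrite mulf_eq0 (gt_eqF s0) => /andP[/eqP].
  rewrite /sesqui !mulr_sumr -big_split; apply: eq_bigr => k _ /=.
  rewrite !mulr_sumr -big_split; apply: eq_bigr => l _ /=.
  by rewrite /choi_form E !mxE; ring.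
exists c => rho; rewrite (linear_choiE rho Ylin).
rewrite (eq_bigr (fun k => \sum_m \sum_m' c m m' *: (rho k.1 k.2 *:
    (A m *m delta_mx k.1 k.2 *m (A m')^t*)))).
  rewrite exchange_big; apply: eq_bigr => m _ /=.
  rewrite exchange_big; apply: eq_bigr => m' _ /=.
  rewrite -scaler_sumr; congr (_ *: _).
  rewrite [in RHS](matrix_sum_delta rho) pair_big mulmx_sumr mulmx_suml.
  by apply: eq_bigr => k _; rewrite -scalemxAr -scalemxAl.
move=> [i j] _; apply/matrixP => a b.
rewrite mxE -[Y _ a b]/(choi_form Y (i, a) (j, b)) cE mulr_sumr summxE.
apply: eq_bigr => m _; rewrite mulr_sumr summxE; apply: eq_bigr => m' _.
by rewrite mxE [X in _ = _ * X]mxE delta_sandwich conjCK /=; ring.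
Qed.

(** [K] stays abstract so that CPT and UCP maps are treated together; the third hypothesis says that
    the normalization built into [K] determines the coefficients. *)
Lemma extreme_kraus_map (K : set ('M[C]_d -> 'M[C]_d)) :
  K kraus_map -> (forall Y, K Y -> linear Y /\ completely_positive Y) ->
  (forall c : 'I_r -> 'I_r -> C,
     K (fun rho => \sum_m \sum_m' c m m' *: (A m *m rho *m (A m')^t*)) ->
     forall m m', c m m' = p * (m == m')%:R) ->
  extreme_point K kraus_map.
Proof.
move=> Kk KCP rigid; split => // Y Z s KY KZ /andP[s0 s1] E.
(* Stated for the first component with a complex weight, then used again with the two maps exchanged
   and weight 1 - s. *)
have main (Y' Z' : 'M[C]_d -> 'M[C]_d) (s' : C) : K Y' -> K Z' -> 0 < s' -> s' < 1 ->
    kraus_map = s' *: Y' + (1 - s') *: Z' -> Y' = kraus_map.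
  move=> KY' KZ' s'0 s'1 E'.
  have [lY cY] := KCP _ KY'; have [_ cZ] := KCP _ KZ'.
  have [c cE] := dominated_by_kraus lY cY cZ s'0 s'1 E'.
  have {}cE : Y' = fun rho => \sum_m \sum_m' c m m' *: (A m *m rho *m (A m')^t*).
    by apply/funext.
  have cp := rigid c; rewrite -cE in cp.
  rewrite cE; apply/funext => rho; rewrite /kraus_map scaler_sumr.
  apply: eq_bigr => m _.
  under eq_bigr => m' _ do rewrite cp // mulrC -scalerA eq_sym.
  by rewrite sum_deltaZ.
have s0' : 0 < s%:C by rewrite ltcR.
have s1' : s%:C < 1 by rewrite ltcR.
split; first by apply: (main Y Z s%:C) => //; rewrite E rmorphB rmorph1.
apply: (main Z Y (1 - s%:C)) => //; rewrite ?subr_gt0 // ?gtrBl //.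
by rewrite E rmorphB rmorph1 opprB addrCA subrr addr0 addrC.
Qed.

Lemma kraus_mapE : kraus_map = fun rho =>
  \sum_m \sum_m' (p * (m == m')%:R) *: (A m *m rho *m (A m')^t*).
Proof.
apply/funext => rho; rewrite /kraus_map scaler_sumr; apply: eq_bigr => m _.
under eq_bigr => m' _ do rewrite mulrC -scalerA eq_sym.
by rewrite sum_deltaZ.
Qed.

(** By cyclicity of the trace, the map preserves traces exactly when its dual fixes the identity.
    Traces against matrix units read off the entries. *)
Lemma trace_preserving_gram (c : 'I_r -> 'I_r -> C) :
  trace_preserving (fun rho => \sum_m \sum_m' c m m' *: (A m *m rho *m (A m')^t*)) ->
  \sum_m \sum_m' c m m' *: ((A m')^t* *m A m) = 1%:M.
Proof.
move=> tp; apply/matrixP => i j.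
have trd X : \tr (X *m delta_mx j i) = X i j.
  rewrite /mxtrace (bigD1 i) //= mxE (bigD1 j) //= mxE !eqxx mulr1.
  rewrite !big1 ?addr0 // => [k ki|k kj].
    by rewrite mxE big1 // => l _; rewrite mxE (negbTE ki) andbF mulr0.
  by rewrite mxE (negbTE kj) mulr0.
rewrite -[RHS]trd mul1mx -tp.
rewrite -trd mulmx_suml !raddf_sum; apply: eq_bigr => m _ /=.
rewrite mulmx_suml !raddf_sum; apply: eq_bigr => m' _ /=.
by rewrite -scalemxAl !linearZ /= [in RHS]mxtrace_mulC mulmxA.
Qed.

Lemma unital_gram (c : 'I_r -> 'I_r -> C) :
  unital (fun rho => \sum_m \sum_m' c m m' *: (A m *m rho *m (A m')^t*)) ->
  \sum_m \sum_m' c m m' *: (A m *m (A m')^t*) = 1%:M.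
Proof.
rewrite /unital => u1; rewrite -[RHS]u1; apply: eq_bigr => m _.
by apply: eq_bigr => m' _; rewrite mulmx1.
Qed.

(** The coefficients [c] and p δ both represent the identity as a combination of the Gram products,
    so their difference is a linear relation and vanishes. *)
Lemma kraus_CPT_extreme :
  (forall c : 'I_r -> 'I_r -> C,
     \sum_m \sum_m' c m m' *: ((A m')^t* *m A m) = 0 -> forall m m', c m m' = 0) ->
  trace_preserving kraus_map -> extreme_point (@CPT R d) kraus_map.
Proof.
move=> Afree tp; apply: extreme_kraus_map => [|Y [] //|c].
  by split => //; [exact: kraus_linear | exact: kraus_cp].
case=> _ _ /trace_preserving_gram c1 m m'; apply/eqP; rewrite -subr_eq0.
apply/eqP/(Afree (fun m m' => c m m' - p * (m == m')%:R)).
rewrite kraus_mapE in tp; have := trace_preserving_gram tp.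
rewrite -[in RHS]c1 => /eqP; rewrite eq_sym -subr_eq0 -sumrB => /eqP e.
rewrite -[RHS]e; apply: eq_bigr => k _; rewrite -sumrB.
by apply: eq_bigr => k' _; rewrite scalerBl.
Qed.

Lemma kraus_UCP_extreme :
  (forall c : 'I_r -> 'I_r -> C,
     \sum_m \sum_m' c m m' *: (A m *m (A m')^t*) = 0 -> forall m m', c m m' = 0) ->
  unital kraus_map -> extreme_point (@UCP R d) kraus_map.
Proof.
move=> Afree u1; apply: extreme_kraus_map => [|Y [] //|c].
  by split => //; [exact: kraus_linear | exact: kraus_cp].
case=> _ _ /unital_gram c1 m m'; apply/eqP; rewrite -subr_eq0.
apply/eqP/(Afree (fun m m' => c m m' - p * (m == m')%:R)).
rewrite kraus_mapE in u1; have := unital_gram u1.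
rewrite -[in RHS]c1 => /eqP; rewrite eq_sym -subr_eq0 -sumrB => /eqP e.
rewrite -[RHS]e; apply: eq_bigr => k _; rewrite -sumrB.
by apply: eq_bigr => k' _; rewrite scalerBl.
Qed.

End Choi.

(** * Factorizations through a von Neumann algebra *)

Section BoundedOperators.
Variables (R : realType) (H : completeNormedModType R[i]).
Local Notation C := R[i].

Lemma bounded_op_id : bounded_op (idfun : H -> H).
Proof. by split => [a x y //|x]; exact: cvg_id. Qed.

Lemma bounded_op_comp (S T : H -> H) :
  bounded_op S -> bounded_op T -> bounded_op (S \o T).
Proof.
move=> [Sl Sc] [Tl Tc]; split=> [a x y /=|x]; first by rewrite Tl Sl.
by apply: continuous_comp; [exact: Tc | exact: Sc].
Qed.

Lemma bounded_op_lin (a : C) (S T : H -> H) :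
  bounded_op S -> bounded_op T -> bounded_op (a *: S + T).
Proof.
move=> [Sl Sc] [Tl Tc]; split=> [b x y|x].
  rewrite -[LHS]/(a *: S (b *: x + y) + T (b *: x + y)) Tl Sl.
  rewrite -[X in _ = _ *: X + _]/(a *: S x + T x).
  rewrite -[X in _ = _ + X]/(a *: S y + T y) !scalerDr !scalerA.
  by rewrite [a * b]mulrC addrACA.
apply: continuousD; last exact: Tc.
by apply: continuousZl_tmp; exact: Sc.
Qed.

Lemma linear_sumZ (I : finType) (T : H -> H) (a : I -> C) (x : I -> H) :
  linear T -> T (\sum_k a k *: x k) = \sum_k a k *: T (x k).
Proof.
move=> Tlin; pose L := GRing.isLinear.Build _ _ _ _ T Tlin.
pose T' : {linear H -> H} := HB.pack T L.
rewrite -[LHS]/(T' _) linear_sum; apply: eq_bigr => k _; exact: linearZ.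
Qed.

Lemma op_sumE (I : finType) (T : I -> H -> H) x :
  (\sum_k T k) x = \sum_k T k x.
Proof. by rewrite fct_sumE. Qed.

Lemma sum_opE (I : finType) (a : I -> C) (T : I -> H -> H) x :
  (\sum_k a k *: T k) x = \sum_k a k *: T k x.
Proof. by rewrite fct_sumE. Qed.

Lemma comp_sumZ (I J : finType) (a : I -> C) (b : J -> C) (S : I -> H -> H)
    (T : J -> H -> H) : (forall k, linear (S k)) ->
  (\sum_k a k *: S k) \o (\sum_l b l *: T l)
  = \sum_k \sum_l (a k * b l) *: (S k \o T l).
Proof.
move=> Slin; apply/funext => x; rewrite op_sumE /= sum_opE.
apply: eq_bigr => k _; rewrite !sum_opE linear_sumZ // scaler_sumr.
by apply: eq_bigr => l _; rewrite scalerA.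
Qed.

Variable dot : {dot H for conjC}.
Hypothesis dotN : norm_of_dot dot.

Lemma dot_eq0 (x : H) : (forall y, dot y x = 0) -> x = 0.
Proof.
by move=> /(_ x); rewrite -dotN => /eqP; rewrite sqrf_eq0 normr_eq0 => /eqP.
Qed.

(** The inner product is nondegenerate, so adjoints are unique and the choice made in [adjoint] is
    immaterial; its default value is excluded by the existence of [T']. *)
Lemma adjoint_eq (T T' : H -> H) : is_adjoint dot T T' -> adjoint dot T = T'.
Proof.
move=> TT'; rewrite /adjoint; case: xgetP => [T'' _ TT''|/(_ T')]; last by case.
apply/funext => x; apply/eqP; rewrite -subr_eq0; apply/eqP/dot_eq0 => y.
apply/eqP; rewrite linearBr subr_eq0; apply/eqP.
exact: etrans (esym (TT'' y x)) (TT' y x).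
Qed.

Lemma is_adjoint_sum (I : finType) (a : I -> C) (T T' : I -> H -> H) :
  (forall k, is_adjoint dot (T k) (T' k)) ->
  is_adjoint dot (\sum_k a k *: T k) (\sum_k conjC (a k) *: T' k).
Proof.
move=> TT' x y; rewrite !sum_opE -[LHS]applyrE linear_sum linear_sumr.
apply: eq_bigr => k _; rewrite [LHS]linearZl_LR [RHS]linearZr_LR /= conjCK.
by rewrite -TT'.
Qed.

End BoundedOperators.

(** * Entries of a factorizing unitary *)

Section Factorization.
Variables (R : realType) (H : completeNormedModType R[i]).
Local Notation C := R[i].
Variables (dot : {dot H for conjC}) (N : set (H -> H)) (tau : (H -> H) -> C).
Hypothesis dotN : norm_of_dot dot.
Hypothesis vN : von_neumann_algebra dot N.
Hypothesis trtau : normal_faithful_trace dot N tau.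

Lemma vna_linear T : N T -> linear T.
Proof. by move=> /(vna_bounded vN) []. Qed.

(** [N] is a commutant by the bicommutant identity, and closure under unit, composition and linear
    combinations is read off from that description here and below. *)
Lemma vna_id : N idfun.
Proof.
by rewrite -(vna_bicommutant vN); split=> [|X _ //]; exact: bounded_op_id.
Qed.

Lemma vna_comp S T : N S -> N T -> N (S \o T).
Proof.
move=> NS NT; rewrite -(vna_bicommutant vN); split.
  by apply: bounded_op_comp; exact: (vna_bounded vN).
move: NS NT; rewrite -{1 2}(vna_bicommutant vN) => -[_ SX] [_ TX] X NX.
apply/funext => x /=; rewrite -[T (X x)]/((T \o X) x) TX //=.
by rewrite -[S (X _)]/((S \o X) _) SX.
Qed.

Lemma vna_lin a S T : N S -> N T -> N (a *: S + T).
Proof.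
move=> NS NT; rewrite -(vna_bicommutant vN); split.
  by apply: bounded_op_lin; exact: (vna_bounded vN).
move: NS NT; rewrite -{1 2}(vna_bicommutant vN) => -[_ SX] [_ TX] X NX.
have [Xl _] := NX.1; apply/funext => x.
rewrite -[LHS]/(a *: (S \o X) x + (T \o X) x) SX // TX //=.
by rewrite -[RHS]/(X (a *: S x + T x)) Xl.
Qed.

Lemma vna0 : N 0.
Proof.
rewrite -(addNr (idfun : H -> H)) -scaleN1r.
by apply: vna_lin; exact: vna_id.
Qed.

Lemma trace0 : tau 0 = 0.
Proof.
have := nft_linear trtau 1 vna0 vna0; rewrite scaler0 addr0 mul1r => /eqP.
by rewrite -subr_eq0 opprD addrA subrr sub0r oppr_eq0 => /eqP.
Qed.

Lemma vna_trace_sum (I : finType) (a : I -> C) (T : I -> H -> H) :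
  (forall k, N (T k)) ->
  N (\sum_k a k *: T k) /\ tau (\sum_k a k *: T k) = \sum_k a k * tau (T k).
Proof.
move=> NT; elim/big_rec2: _ => [|k y T' _ [NT' <-]].
  by split; [exact: vna0 | exact: trace0].
by split; [exact: vna_lin | exact: (nft_linear trtau)].
Qed.

Lemma vna_adjointP T : N T -> N (adjoint dot T) /\ is_adjoint dot T (adjoint dot T).
Proof. by move=> /(vna_adjoint vN) [T' NT' TT']; rewrite (adjoint_eq dotN TT'). Qed.

Variables (d r : nat) (A : 'I_r -> 'M[C]_d) (p : C).
Variable U : 'M[H -> H]_d.
Hypothesis NU : forall i j, N (U i j).
Hypothesis unitaryU : opmx_unitary dot U.
Hypothesis factU : forall rho, kraus_map A p rho =
  map_mx tau (opmx_mul (opmx_mul (opmx_adjoint dot U) (opmx_scalar H rho)) U).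

Local Notation Uk k := (U k.1 k.2).
Local Notation adjU k := (adjoint dot (U k.1 k.2)).

(** On a matrix unit a single term of the double product survives. The Choi form is therefore the
    Gram matrix of the entries of [U] for the inner product tau(S^* T). *)
Lemma factor_choi_form (k l : 'I_d * 'I_d) :
  choi_form (kraus_map A p) k l = tau (adjU k \o Uk l).
Proof.
have N0 i j x : adjoint dot (U i j) (0 *: x) = 0.
  have [/vna_linear lin _] := vna_adjointP (NU i j).
  by have := lin (-1) 0 0; rewrite scaler0 addr0 scaleN1r addNr scale0r.
rewrite /choi_form factU mxE mxE; congr tau; apply/funext => x.
rewrite op_sumE (bigD1 l.1) //= big1 ?addr0 => [|m /negbTE ml].
  rewrite mxE op_sumE (bigD1 k.1) //= big1 ?addr0 => [|m /negbTE mk].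
    by rewrite !mxE !eqxx scale1r.
  by rewrite !mxE mk /= N0.
by rewrite mxE op_sumE big1 // => i _; rewrite !mxE /= ml andbF N0.
Qed.

(** If [w] annihilates the Kraus family, T = Σ w_k U_k satisfies tau(T^* T) = 0 by the Gram
    description, and faithfulness gives T = 0. The entries of [U] thus expand in the Kraus
    entries. *)
Lemma factor_in_span :
  exists v v' : 'I_r -> H -> H, (forall m, linear (v m) /\ linear (v' m)) /\
    forall j b, U j b = \sum_m conjC (A m b j) *: v m /\
      adjoint dot (U j b) = \sum_m A m b j *: v' m.
Proof.
have [P spanP] := family_in_span (fun m (k : 'I_d * 'I_d) => conjC (A m k.2 k.1)).
have adjP k := vna_adjointP (NU k.1 k.2).
have adj_sum a : adjoint dot (\sum_(k : 'I_d * 'I_d) a k *: Uk k)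
    = \sum_(k : 'I_d * 'I_d) conjC (a k) *: adjU k.
  by apply: (adjoint_eq dotN); apply: is_adjoint_sum => k; case: (adjP k).
have lin_sum (T : 'I_d * 'I_d -> H -> H) a :
    (forall k, N (T k)) -> linear (\sum_k a k *: T k).
  by move=> NT; case: (vna_trace_sum a NT) => /vna_linear.
(* Conjugating the coefficients and taking adjoints of the entries makes [v' m] the adjoint of
   [v m]. *)
pose v m := \sum_l P l m *: Uk l; pose v' m := \sum_l conjC (P l m) *: adjU l.
exists v, v'; split=> [m|j b].
  by split; apply: lin_sum => k; [exact: NU | case: (adjP k)].
have Uv : U j b = \sum_m conjC (A m b j) *: v m.
  rewrite -[LHS]/((fun k => Uk k) (j, b)) spanP // => w /sesqui_kraus_eq0 w0.
  set T := \sum_k _; have [NT _] : N T /\ _ := vna_trace_sum w (fun k => NU k.1 k.2).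
  apply: (nft_faithful trtau NT).
  rewrite -[RHS](w0 p) /T adj_sum comp_sumZ; last first.
    by move=> k; apply: vna_linear; case: (adjP k).
  rewrite pair_bigA /=.
  have NUU (q : ('I_d * 'I_d) * ('I_d * 'I_d)) : N (adjU q.1 \o Uk q.2).
    by apply: vna_comp; [case: (adjP q.1) | exact: NU].
  have [_ ->] := vna_trace_sum (fun q => conjC (w q.1) * w q.2) NUU.
  rewrite /sesqui pair_bigA; apply: eq_bigr => q _ /=.
  by rewrite factor_choi_form mulrAC.
split=> //; rewrite Uv.
rewrite (_ : \sum_m _ = \sum_l (\sum_m conjC (A m b j) * P l m) *: Uk l).
  rewrite adj_sum; under [RHS]eq_bigr => m _ do rewrite scaler_sumr.
  rewrite exchange_big; apply: eq_bigr => l _ /=.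
  rewrite rmorph_sum scaler_suml; apply: eq_bigr => m _.
  by rewrite rmorphM /= conjCK scalerA.
under eq_bigr => m _ do rewrite scaler_sumr.
rewrite exchange_big; apply: eq_bigr => l _ /=.
by rewrite scaler_suml; apply: eq_bigr => m _; rewrite scalerA.
Qed.

(** The scalar solution p δ is known. Subtracting its multiple of [e] leaves a homogeneous relation
    with coefficients in [V], where freeness of the [B m m'] applies. *)
Lemma free_gram_coef (V : lmodType C) (B : 'I_r -> 'I_r -> 'M[C]_d)
    (T : 'I_r -> 'I_r -> V) (e : V) :
  (forall c : 'I_r -> 'I_r -> C,
     \sum_m \sum_m' c m m' *: B m m' = 0 -> forall m m', c m m' = 0) ->
  \sum_m \sum_m' (p * (m == m')%:R) *: B m m' = 1%:M ->
  (forall i j, \sum_m \sum_m' B m m' i j *: T m m' = (1%:M : 'M[C]_d) i j *: e) ->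
  forall m m', T m m' = (p * (m == m')%:R) *: e.
Proof.
move=> Bfree B1 BT m m'; apply/eqP; rewrite -subr_eq0; apply/eqP.
apply: (free_family_module (G := fun q (k : 'I_d * 'I_d) => B q.1 q.2 k.1 k.2)
  (T := fun q => T q.1 q.2 - (p * (q.1 == q.2)%:R) *: e)
  _ _ (m, m')) => [c c0 [m1 m2]|[i j] /=].
  apply: (Bfree (fun m m' => c (m, m'))); apply/matrixP => i j.
  rewrite summxE [RHS]mxE -[RHS](c0 (i, j)) sum_pairE; apply: eq_bigr => k _.
  by rewrite summxE; apply: eq_bigr => k' _; rewrite mxE.
rewrite sum_pairE /=; transitivity (\sum_m \sum_m' B m m' i j *: T m m'
   - (\sum_m \sum_m' (p * (m == m')%:R) *: B m m') i j *: e).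
  rewrite summxE scaler_suml -sumrB; apply: eq_bigr => k _.
  rewrite summxE scaler_suml -sumrB; apply: eq_bigr => k' _.
  by rewrite mxE scalerBr scalerA mulrC.
by rewrite B1 BT subrr.
Qed.

Hypothesis p_neq0 : p != 0.
Hypothesis gramL_free : forall c : 'I_r -> 'I_r -> C,
  \sum_m \sum_m' c m m' *: ((A m')^t* *m A m) = 0 -> forall m m', c m m' = 0.
Hypothesis gramR_free : forall c : 'I_r -> 'I_r -> C,
  \sum_m \sum_m' c m m' *: (A m *m (A m')^t*) = 0 -> forall m m', c m m' = 0.
Hypothesis kraus_tp : trace_preserving (kraus_map A p).
Hypothesis kraus_unital : unital (kraus_map A p).

Lemma no_exact_factorization (m0 m1 : 'I_r) : m0 != m1 -> False.
Proof.
move=> m01; have [v [v' [vlin Uv]]] := factor_in_span.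
have [UU1 UU2] := unitaryU.
(* U^* U = 1 is compared with unitality of the Kraus map; below, U U^* = 1 is compared with trace
   preservation. *)
have v'v m m' : v' m \o v m' = (p * (m == m')%:R) *: idfun.
  apply: (free_gram_coef (B := fun m m' => A m *m (A m')^t*)
    (T := fun m m' => v' m \o v m')) => //.
    by apply: unital_gram; rewrite -kraus_mapE.
  move=> i j; move/matrixP/(_ i j): UU1; rewrite !mxE => <-.
  have UUE k : opmx_adjoint dot U i k \o U k j = \sum_m \sum_m'
      (A m i k * conjC (A m' j k)) *: (v' m \o v m').
    by rewrite mxE (Uv k i).2 (Uv k j).1 comp_sumZ // => l; case: (vlin l).
  under [RHS]eq_bigr => k _ do rewrite UUE.
  rewrite [RHS]exchange_big; apply: eq_bigr => l _ /=.
  rewrite [RHS]exchange_big; apply: eq_bigr => l' _ /=.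
  by rewrite mxE scaler_suml; apply: eq_bigr => k _; rewrite !mxE.
have vv' m m' : v m' \o v' m = (p * (m == m')%:R) *: idfun.
  apply: (free_gram_coef (B := fun m m' => (A m')^t* *m A m)
    (T := fun m m' => v m' \o v' m)) => //.
    by apply: trace_preserving_gram; rewrite -kraus_mapE.
  move=> i j; move/matrixP/(_ i j): UU2; rewrite !mxE => <-.
  have UUE k : U i k \o opmx_adjoint dot U k j = \sum_m \sum_m'
      (conjC (A m k i) * A m' k j) *: (v m \o v' m').
    by rewrite mxE (Uv i k).1 (Uv j k).2 comp_sumZ // => l; case: (vlin l).
  under [RHS]eq_bigr => k _ do rewrite UUE.
  rewrite exchange_big [RHS]exchange_big; apply: eq_bigr => l _ /=.
  rewrite [RHS]exchange_big; apply: eq_bigr => l' _ /=.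
  by rewrite mxE scaler_suml; apply: eq_bigr => k _; rewrite !mxE.
have v'0 x : v' m0 x = 0.
  have : (v' m0 \o v m1) (v' m1 x) = v' m0 ((v m1 \o v' m1) x) by [].
  rewrite v'v vv' eqxx (negbTE m01) mulr1 mulr0 scale0r.
  have lin := (vlin m0).2; have v'00 : v' m0 0 = 0.
    by have := lin (-1) 0 0; rewrite scaler0 addr0 scaleN1r addNr.
  have := lin p x 0; rewrite addr0 v'00 addr0 => e.
  rewrite -[X in _ = v' m0 X]/(p *: x) e => /esym/eqP.
  by rewrite scaler_eq0 (negbTE p_neq0) => /eqP.
(* Now p times the identity operator is 0, so the identity is 0, against [tau idfun = 1]. *)
have : (p * (m0 == m0)%:R) *: (idfun : H -> H) = 0.
  by rewrite -v'v; apply/funext => x /=; rewrite v'0.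
rewrite eqxx mulr1 => /(congr1 (fun T => p^-1 *: T)).
rewrite scalerA mulVf // scale1r scaler0 => id0.
have := nft_normalized trtau; rewrite id0 trace0 => /eqP.
by rewrite eq_sym oner_eq0.
Qed.

End Factorization.

(** * The matrices A_m *)

Section Construction.
Variables (R : realType) (n : nat).
Local Notation C := R[i].

Definition shift_perm : 'S_n.+1 := perm (can_inj (@ordSK n.+1)).

Lemma shift_mxE : shift_mx R n = perm_mx shift_perm.
Proof.
apply/matrixP => i j; rewrite summxE (bigD1 i) //= big1 ?addr0 => [|k ki].
  by rewrite !mxE permE eqxx eq_sym.
by rewrite mxE eq_sym (negbTE ki).
Qed.

Lemma perm_mxX (s : 'S_n.+1) k : perm_mx (s ^+ k)%g = perm_mx s ^+ k :> 'M[C]_n.+1.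
Proof.
elim: k => [|k IH]; first by rewrite perm_mx1.
by rewrite expgS exprS perm_mxM IH.
Qed.

Lemma shift_permX (m : 'I_n.+1) : (shift_perm ^+ m)%g ord0 = m.
Proof.
apply: val_inj => /=; case: m => m /=; elim: m => [|m IH] mn.
  by rewrite expg0 perm1.
by rewrite expgSr permM permE /= IH ?modn_small // ltnW.
Qed.

(** S is the matrix of the cyclic permutation, so conjugating by its powers only relabels rows and
    columns. *)
Lemma A_mx_conj (t : R) (m i j : 'I_n.+1) (u := (shift_perm ^+ m)^-1%g) :
  A_mx t m i j = (block_mx (t%:C)%:M 0 0 (W_mx R n) : 'M[C]_(1 + n)) (u i) (u j).
Proof.
rewrite /A_mx shift_mxE -perm_mxX -perm_mxV -/u.
rewrite -[X in _ * perm_mx X]invgK -/u -!mulmxE -col_permE -row_permE.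
by rewrite !mxE.
Qed.

Lemma W_mxE i j : W_mx R n i j = 2 / n%:R - (i == j)%:R.
Proof.
have cc : conjC (sqrtC n%:R : C)^-1 = (sqrtC n%:R)^-1.
  by rewrite fmorphV /= conj_Creal // ger0_real // sqrtC_ge0 ler0n.
by rewrite !mxE big_ord1 !mxE cc -invfM -expr2 sqrtCK.
Qed.

Lemma A_mxE (t : R) (m i j : 'I_n.+1) : A_mx t m i j = A_entry t%:C m i j.
Proof.
rewrite (A_mx_conj t m i j); set u := (_^-1)%g.
(* The relabelling sends m to 0, so whether an index lies in the 1 x 1 block is decided by its
   equality with m. *)
have u0 : u m = ord0 by rewrite -[X in u X](shift_permX m) permK.
have uE k : (k == m) = (u k == ord0) by rewrite -u0 (inj_eq (@perm_inj _ u)).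
rewrite /A_entry !uE -[i == j](inj_eq (@perm_inj _ u)).
move: (u i) (u j) => {uE}i' j'; move: i' j' => {}i {}j.
rewrite -!(inj_eq val_inj) /=.
case: (@split_ordP 1 n i) => i' ->; case: (@split_ordP 1 n j) => j' -> /=.
- by rewrite block_mxEul !mxE !ord1 /=; ring.
- by rewrite block_mxEur !mxE !ord1 /=; ring.
- by rewrite block_mxEdl !mxE !ord1 /=; ring.
by rewrite block_mxEdr W_mxE /= !add1n eqSS (inj_eq val_inj); ring.
Qed.

Lemma A_mx_hermitian (t : R) (m : 'I_n.+1) : (A_mx t m)^t* = A_mx t m.
Proof.
have tr : conjC t%:C = t%:C.
  by rewrite conj_Creal // realE !lecR le_total.
apply/matrixP => i j; rewrite mxE [X in conjC X]mxE !A_mxE /A_entry.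
rewrite !(rmorphB, rmorphD, rmorphM, fmorphV, rmorph_nat, rmorph1) /= tr.
by rewrite (eq_sym j i) (mulrC (j == m)%:R) (mulrC (1 - (j == m)%:R)).
Qed.

Lemma Phi_mapE (t : R) :
  @Phi_map R n t = kraus_map (A_mx t) ((n%:R + t ^+ 2)^-1)%:C.
Proof.
apply/funext => rho; congr (_ *: _); apply: eq_bigr => m _.
by rewrite A_mx_hermitian.
Qed.

Lemma A_mx_mulE (t : R) (m m' i j : 'I_n.+1) :
  (A_mx t m *m A_mx t m') i j = \sum_k A_entry t%:C m i k * A_entry t%:C m' k j.
Proof. by rewrite mxE; apply: eq_bigr => k _; rewrite !A_mxE. Qed.

End Construction.

(** * Freeness, extremality and non-factorizability of Φ *)

Lemma free_image (F : fieldType) (V : vectType F) (I : finType) (f : I -> V) :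
  (forall c : I -> F, \sum_k c k *: f k = 0 -> forall k, c k = 0) ->
  free [seq f k | k : I].
Proof.
move=> f_free; suff: free (image_tuple f I) by []; apply/freeP => c c0 i.
rewrite -(enum_valK i); apply: (f_free (fun k => c (enum_rank k))).
rewrite -[RHS]c0 [LHS](reindex_onto enum_val enum_rank); last first.
  by move=> ? _; rewrite enum_rankK.
apply: eq_big => [k|k _]; first by rewrite enum_valK eqxx.
by rewrite enum_valK nth_image.
Qed.

Theorem theorem3p11 (R : realType) (n : nat) (hd : (3 <= n.+1)%N) (t : R)
    (ht : -1 < t < 1) :
  (forall m : 'I_n.+1, (A_mx t m)^t* = A_mx t m) /\
  (t != -1 / n%:R ->
    [/\ free [seq A_mx t p.1 *m A_mx t p.2 | p : 'I_n.+1 * 'I_n.+1],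
        extreme_point (@CPT R n.+1) (Phi_map t) /\
        extreme_point (@UCP R n.+1) (Phi_map t) &
        ~ factorizable (@Phi_map R n t)]).
Proof.
have n_ge2 : (2 <= n)%N by [].
have n_gt0 : (0 < n)%N := ltnW n_ge2.
have [tN1 t1] := andP ht.
have A_herm := @A_mx_hermitian R n t; split=> // tn.
have nt0 : 1 + n%:R * t%:C != 0 :> R[i].
  apply: contraNneq tn => e; apply/eqP; apply: complexI.
  rewrite rmorphM rmorphN rmorph1 fmorphV rmorph_nat /=.
  have n0 : n%:R != 0 :> R[i] by rewrite pnatr_eq0 -lt0n.
  by apply: (mulfI n0); rewrite mulrCA divff // mulr1; apply/eqP;
     rewrite -addr_eq0 addrC e.
have tN1c : -1 < t%:C by rewrite -(rmorphN1 (real_complex R)) ltcR.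
have t1c : t%:C < 1 by rewrite ltcR.
have A_free (c : 'I_n.+1 -> 'I_n.+1 -> R[i]) :
    \sum_m \sum_m' c m m' *: (A_mx t m *m A_mx t m') = 0 ->
    forall m m', c m m' = 0.
  move=> /matrixP c0; apply: (A_entry_products_free n_ge2 tN1c t1c nt0) => i j.
  have := c0 i j; rewrite [RHS]mxE summxE; apply: etrans; apply: eq_bigr => m _.
  by rewrite summxE; apply: eq_bigr => m' _; rewrite mxE A_mx_mulE.
have gramL (c : 'I_n.+1 -> 'I_n.+1 -> R[i]) :
    \sum_m \sum_m' c m m' *: ((A_mx t m')^t* *m A_mx t m) = 0 ->
    forall m m', c m m' = 0.
  (* The Gram products come in the order A_m' A_m, whence the transposed coefficients. *)
  move=> c0 m m'; apply: (A_free (fun m m' => c m' m)).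
  rewrite exchange_big -[RHS]c0; apply: eq_bigr => k _.
  by apply: eq_bigr => l _; rewrite A_herm.
have gramR (c : 'I_n.+1 -> 'I_n.+1 -> R[i]) :
    \sum_m \sum_m' c m m' *: (A_mx t m *m (A_mx t m')^t*) = 0 ->
    forall m m', c m m' = 0.
  move=> c0; apply: A_free; rewrite -[RHS]c0.
  by apply: eq_bigr => k _; apply: eq_bigr => l _; rewrite A_herm.
pose p := ((n%:R + t ^+ 2)^-1)%:C.
have q_gt0 : 0 < n%:R + t ^+ 2 by rewrite ltr_wpDr ?sqr_ge0 // ltr0n.
have p_gt0 : 0 < p by rewrite ltcR invr_gt0.
(* A diagonal entry of the sum of the squares receives t^2 once and 1 from each of the n other
   indices. As the [A_m] are Hermitian, this gives both trace preservation and unitality. *)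
have sum1 : p *: \sum_m A_mx t m *m A_mx t m =
    1%:M :> 'M[R[i]]_n.+1.
  apply/matrixP => i j; rewrite mxE summxE.
  under eq_bigr => m _ do rewrite A_mx_mulE A_entry_sqr // [i == m]eq_sym mulrC.
  rewrite -mulr_suml big_split /= sumr_const card_ord.
  under eq_bigr => m _ do rewrite mulrC.
  rewrite sum_deltal mulrA [RHS]mxE -[RHS]mul1r; congr (_ * _).
  rewrite -natr1 addrACA subrr addr0.
  rewrite (_ : n%:R + _ = (n%:R + t ^+ 2)%:C); last first.
    by rewrite rmorphD rmorphXn rmorph_nat.
  by rewrite /p -rmorphM mulVf ?rmorph1 // gt_eqF.
have tp : trace_preserving (kraus_map (@A_mx R n t) p).
  move=> rho; rewrite -[in RHS](mul1mx rho) -sum1 -scalemxAl !linearZ /=.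
  rewrite mulmx_suml !raddf_sum; congr (_ * _); apply: eq_bigr => m _ /=.
  by rewrite A_herm mxtrace_mulC mulmxA.
have un : unital (kraus_map (@A_mx R n t) p).
  rewrite /unital -[RHS]sum1; congr (_ *: _); apply: eq_bigr => m _.
  by rewrite mulmx1 A_herm.
rewrite Phi_mapE; split.
- apply: free_image => c; rewrite sum_pairE => c0 [m m'].
  exact: (A_free (fun m m' => c (m, m'))).
- by split; [apply: kraus_CPT_extreme | apply: kraus_UCP_extreme];
    rewrite ?(ltW p_gt0).
move=> [H [dot [N [tau [dotN vN trtau [U [NU unitU factU]]]]]]].
have ord01 : ord0 != lift ord0 (Ordinal n_gt0) :> 'I_n.+1 by [].
exact: (no_exact_factorization dotN vN trtau NU unitU factU
  (lt0r_neq0 p_gt0) gramL gramR tp un ord01).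
Qed.
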